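(* Let $q$ be a prime power, $n\ge 2$ an integer and $k\le n-1$ a nonnegative integer, and suppose there exist $k$-normal elements in $\mathbb{F}_{q^n}$ over $\mathbb{F}_q$. Then there exists a $k$-normal element of $\mathbb{F}_{q^n}$ whose multiplicative order is at least $$\tau(k,q,n):=4^{(k-n)/q}\cdot q^{\,n-k-\frac{1.1n}{\log\log(q^n-1)}}.$$
   Context: $\log$ denotes the natural logarithm. An element $\alpha\in\mathbb{F}_{q^n}$ is $k$-normal over $\mathbb{F}_q$ if the $\mathbb{F}_q$-vector space spanned by $\alpha,\alpha^q,\dots,\alpha^{q^{n-1}}$ has dimension $n-k$. *)

(* Defs.v *)
From HB Require Import structures.
From mathcomp Require Import all_boot all_order all_algebra all_fingroup all_field.
From Stdlib Require Import Reals.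
Set Implicit Arguments. Unset Strict Implicit. Unset Printing Implicit Defensive.
Import GRing.Theory.

(* F plays the role of F_q, L (a finite-dimensional extension of F) of F_{q^n}.
   frob_span q n a = the F-span of a, a^q, ..., a^(q^(n-1)). *)
Definition frob_span (F : fieldType) (L : fieldExtType F) (q n : nat) (a : L)
  : {vspace L} :=
  span [seq GRing.exp a (expn q i) | i <- iota 0 n].

(* a is k-normal over F (with q = #|F|, n = [L:F]) *)
Definition k_normal (F : fieldType) (L : fieldExtType F) (q n k : nat) (a : L)
  : Prop :=
  \dim (frob_span q n a) = (n - k)%N.

Definition tau (k q n : nat) : R :=
  (Rpower 4 ((INR k - INR n) / INR q) *
   Rpower (INR q)
     (INR n - INR k - (11/10) * INR n / ln (ln (INR q ^ n - 1))))%R.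

(* Main.v *)
(** Let [N = q^n - 1] and [r = n - k].  A [k]-normal element [x] generates a cyclic
    [F[X]]-module [F[X]/(h)] with [deg h >= r], [X] acting as the Frobenius, and
    [g.x] is again [k]-normal whenever [g] is coprime to [h].  Adjoining the
    irreducible factors of [h] one at a time shows that there are at least
    [(q-1)^r >= 4^(-r/q) q^r] such [g] modulo [h].

    If [t] is the largest order of these elements, then, [F_{q^n}^*] being cyclic,
    their number is at most [sum_x t/ord(x) = t P(N)/N], where
    [P(N) = sum_(d | N) phi(d) N/d].  It remains to see that
    [log (P(N)/N) <= 1.1 log N / log log N].  As [P(N)/N] is the product of the
    [1 + a(1 - 1/p)] over the [p^a] exactly dividing [N], for every integer [m]
    it is at most [(e^kappa_m N)^(1/m)], where only the primes [p < 2^m] contribute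
    to [kappa_m].  One uses the [m] with [m - 1 <= log log N <= m]; it suffices that
    [kappa_m] is a small multiple of [e^m], which is a finite computation for
    [m <= 10] and follows from crude bounds for [m >= 11]. *)

Require Import Defs.
From HB Require Import structures.
From mathcomp Require Import all_boot all_order all_algebra all_fingroup all_field.
From mathcomp Require Import all_solvable.
From Stdlib Require Import BinNat Nnat Reals Lra Psatz.
From mathcomp Require Import zify ring.

Set Implicit Arguments. Unset Strict Implicit. Unset Printing Implicit Defensive.
Import GRing.Theory.

(* The Stdlib imports rebind the key [%N] and the notation [^] of [nat_scope]. *)
Delimit Scope nat_scope with N.
Delimit Scope N_scope with num.
Local Notation "m ^ n" := (expn m n) : nat_scope.

(** * The function P *)

(** Pillai's function, the sum of [gcd(j, N)] over [1 <= j <= N]. It arises here as the sum of the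
    indices [N / ord(x)] over a cyclic group of order [N]. *)
Definition pillai (N : nat) : nat := \sum_(d <- divisors N) totient d * (N %/ d).

Lemma perm_divisors_pfactorM (p a M : nat) :
  prime p -> coprime p M -> 0 < M ->
  perm_eq (divisors (p ^ a * M))
          [seq p ^ i * d | i <- iota 0 a.+1, d <- divisors M].
Proof.
move=> p_pr copM M_gt0; have p_gt0 := prime_gt0 p_pr.
have cop d : d %| M -> logn p d = 0.
  by move=> dM; apply: logn_coprime; apply: coprime_dvdr dM copM.
apply: uniq_perm; first exact: divisors_uniq.
  apply: allpairs_uniq; [exact: iota_uniq|exact: divisors_uniq|].
  move=> [i d] [j e] id_in je_in /= eq_ij.
  have dM : d \in divisors M by case/allpairsP: id_in => -[x y] /= [_ ? [_ ->]].
  have eM : e \in divisors M by case/allpairsP: je_in => -[x y] /= [_ ? [_ ->]].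
  rewrite -!dvdn_divisors // in dM eM.
  have d_gt0 := dvdn_gt0 M_gt0 dM; have e_gt0 := dvdn_gt0 M_gt0 eM.
  have := congr1 (logn p) eq_ij.
  rewrite !lognM ?expn_gt0 ?p_gt0 // !pfactorK //.
  rewrite !cop // !addn0 => eij; move: eq_ij.
  by rewrite eij => /eqP; rewrite eqn_pmul2l ?expn_gt0 ?p_gt0 // => /eqP ->.
move=> d; rewrite -dvdn_divisors ?muln_gt0 ?expn_gt0 ?p_gt0 //.
apply/idP/allpairsP => [dvd|[[i e] /= [ii eM ->]]]; last first.
  rewrite -dvdn_divisors // in eM; apply: dvdn_mul => //.
  by rewrite dvdn_exp2l //; move: ii; rewrite inE mem_iota; lia.
have d_gt0 : 0 < d by apply: dvdn_gt0 dvd; rewrite muln_gt0 expn_gt0 p_gt0.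
have [e pe d_eq] := pfactor_coprime p_pr d_gt0.
exists (logn p d, e) => /=; split; last by rewrite mulnC.
  rewrite -/(iota 0 a.+1) mem_iota /= add0n ltnS.
  have := dvdn_leq_log p _ dvd; rewrite muln_gt0 expn_gt0 p_gt0 M_gt0 => /(_ isT).
  rewrite lognM ?expn_gt0 ?p_gt0 // pfactorK //.
  by rewrite (cop M) // addn0.
rewrite -dvdn_divisors //.
have : e %| p ^ a * M by apply: dvdn_trans dvd; rewrite d_eq dvdn_mulr.
by rewrite Gauss_dvdr // coprime_sym coprimeXl.
Qed.

(** In [P(p^a)] the divisor 1 contributes [p^a] and each of the other [a] divisors
    [(p - 1) p^(a-1)]. The extra factor [p] avoids a quotient. *)
Lemma pillai_pfactorM (p a M : nat) :
  prime p -> coprime p M -> 0 < M ->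
  p * pillai (p ^ a * M) = p ^ a * (p + a * (p - 1)) * pillai M.
Proof.
move=> p_pr copM M_gt0; have p_gt0 := prime_gt0 p_pr.
have -> : pillai (p ^ a * M) =
          (\sum_(0 <= i < a.+1) totient (p ^ i) * p ^ (a - i)) * pillai M.
  rewrite /pillai (perm_big _ (perm_divisors_pfactorM _ _ _ _)) //.
  rewrite big_allpairs_dep big_distrl /index_iota subn0.
  apply: eq_big_seq => i; rewrite mem_iota add0n ltnS => /= le_ia.
  rewrite big_distrr /=; apply: eq_big_seq => d; rewrite -dvdn_divisors // => dM.
  rewrite totient_coprime; last first.
    by apply: coprimeXl; apply: coprime_dvdr dM copM.
  have -> : p ^ a * M = (p ^ i * d) * (p ^ (a - i) * (M %/ d)).
    rewrite -mulnA [d * _]mulnCA -{1}(subnKC le_ia) expnD -mulnA.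
    by rewrite [d * _]mulnC divnK.
  rewrite mulKn ?muln_gt0 ?expn_gt0 ?p_gt0 ?(dvdn_gt0 M_gt0) //.
  by rewrite mulnACA.
rewrite mulnA; congr (_ * _).
rewrite big_nat_recl // expn0 (_ : totient 1 = 1) // mul1n subn0.
rewrite (eq_big_nat _ _ (F2 := fun _ => (p - 1) * p ^ a.-1)); last first.
  move=> i /andP[_ lt_ia]; rewrite totient_pfactor // -subn1 -mulnA -expnD.
  by congr (_ * p ^ _); lia.
rewrite sum_nat_const_nat subn0 mulnDr [p ^ a * (_ + _)]mulnDr [p * p ^ a]mulnC.
congr (_ + _); case: a => [|a]; first by rewrite !mul0n !muln0.
rewrite /= expnS; ring.
Qed.

Lemma pillai_gt0 (N : nat) : 0 < N -> 0 < pillai N.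
Proof.
move=> N_gt0; rewrite /pillai (big_rem N) ?divisors_id //=.
by rewrite divnn N_gt0 muln1 addn_gt0 totient_gt0 N_gt0.
Qed.

(** [P(N)/N] is a product over the prime powers of [N], so local bounds multiply; [e p] is the loss
    at [p] in bits. For [M = m s] the conclusion is the [s]-th power of a bound on [(P(N)/N)^m] by a
    constant times [N]. *)
Lemma pillai_bound (M s : nat) (e : nat -> nat) :
  (forall p a, prime p -> 0 < a ->
     (p + a * (p - 1)) ^ M <= 2 ^ e p * p ^ (M + s * a)) ->
  forall N, 0 < N -> pillai N ^ M <= 2 ^ (\sum_(p <- primes N) e p) * N ^ (M + s).
Proof.
move=> e_bound; elim/ltn_ind => N IH N_gt0.
have [N_gt1|] := ltnP 1 N; last first.
  case: N N_gt0 {IH} => [|[|]] // _ _.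
  by rewrite /pillai /= !big_cons !big_nil /= !exp1n.
pose p := pdiv N; have p_pr : prime p by apply: pdiv_prime.
have p_gt0 := prime_gt0 p_pr.
have [K copK N_eq] := pfactor_coprime p_pr N_gt0.
set a := logn p N in N_eq.
have a_gt0 : 0 < a by rewrite logn_gt0 mem_primes p_pr N_gt0 pdiv_dvd.
have K_gt0 : 0 < K by move: N_gt0; rewrite N_eq muln_gt0 => /andP[].
have pa_gt1 : 1 < p ^ a by rewrite -{1}(exp1n a) ltn_exp2r // prime_gt1.
have lt_KN : K < N by rewrite N_eq -{1}(muln1 K) ltn_pmul2l.
have -> : \sum_(r <- primes N) e r = e p + \sum_(r <- primes K) e r.
  transitivity (\sum_(r <- p :: primes K) e r); last by rewrite big_cons.
  apply: perm_big; apply: uniq_perm; first exact: primes_uniq.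
    rewrite /= primes_uniq andbT mem_primes K_gt0 p_pr /=.
    by rewrite -prime_coprime.
  move=> r; rewrite N_eq primesM ?expn_gt0 ?p_gt0 // inE primesX // (primes_prime p_pr).
  by rewrite inE orbC.
have le_MK := leq_mul (e_bound p a p_pr a_gt0) (IH K lt_KN K_gt0).
have := pillai_pfactorM a p_pr copK K_gt0; rewrite [p ^ a * K]mulnC -N_eq.
move=> /(congr1 (expn^~ M)); rewrite /= !expnMn => pillai_eq.
rewrite -(leq_pmul2l (m := p ^ M)) ?expn_gt0 ?p_gt0 // pillai_eq -mulnA.
have -> : p ^ M * (2 ^ (e p + \sum_(r <- primes K) e r) * N ^ (M + s)) =
    (p ^ a) ^ M * (2 ^ e p * p ^ (M + s * a) *
                   (2 ^ (\sum_(r <- primes K) e r) * K ^ (M + s))).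
  rewrite N_eq expnMn [s * a]mulnC [p ^ (_ + _)]expnD [p ^ (a * s)]expnM.
  rewrite [_ ^ (e p + _)]expnD [(p ^ a) ^ (_ + _)]expnD.
  ring.
by rewrite leq_mul2l le_MK orbT.
Qed.

(** * Element orders in a cyclic group *)

(** A cyclic group has at most one subgroup of order [d], so all elements of order [d] generate the
    same subgroup. *)
Lemma card_order_cyclic (gT : finGroupType) (G : {group gT}) (d : nat) :
  cyclic G -> #|[set x in G | #[x]%g == d]| <= totient d.
Proof.
move=> cycG; set A := [set x in G | _].
have [->|[x]] := set_0Vmem A; first by rewrite cards0.
rewrite inE => /andP[xG /eqP ox]; rewrite -ox.
rewrite totient_gen; apply/subset_leq_card/subsetP=> y.
rewrite !inE => /andP[yG /eqP oxy]; rewrite /generator.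
by rewrite (eq_subG_cyclic cycG) ?cycle_subG //; apply/eqP; rewrite -!orderE ox.
Qed.

Lemma sum_card_div_order_cyclic (gT : finGroupType) (G : {group gT}) :
  cyclic G -> \sum_(x in G) #|G| %/ #[x]%g <= pillai #|G|.
Proof.
move=> cycG.
have split x : x \in G ->
    #|G| %/ #[x]%g = \sum_(d <- divisors #|G| | #[x]%g == d) #|G| %/ d.
  move=> xG; rewrite -big_filter (perm_big [:: #[x]%g]) ?big_seq1 //.
  apply: uniq_perm; rewrite ?filter_uniq ?divisors_uniq // => d.
  rewrite mem_filter inE eq_sym; case: eqP => //= ->.
  by rewrite -dvdn_divisors ?cardG_gt0 // order_dvdG.
rewrite (eq_bigr _ split) (exchange_big_dep xpredT) //=.
apply: leq_sum => d _; rewrite sum_nat_const leq_mul2r; apply/orP; right.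
by apply: leq_trans (card_order_cyclic d cycG); rewrite cardsE.
Qed.
(** * Counting k-normal elements *)

Section CountKNormal.
Local Open Scope ring_scope.

(** Write [h = h1 f] with [f] irreducible. Residues modulo [h] are [g + u h1] with [deg u < deg f];
    for [g] coprime to [h1] at most one [u] makes [f] divide this, leaving at least
    [q^(deg f) - 1 >= (q-1)^(deg f)] choices. *)
Lemma count_coprime_poly (F : finFieldType) (h : {poly F}) : h != 0 ->
  exists l : seq {poly F},
    [/\ uniq l, {in l, forall g : {poly F}, (size g < size h)%N && coprimep g h}
      & ((#|F| - 1) ^ (size h).-1 <= size l)%N].
Proof.
elim: {h}_.+1 {-2}h (ltnSn (size h)) => // k IH h lt_hk h_neq0.
have [h_le1|h_gt1] := leqP (size h) 1.
  have size_h : size h = 1%N.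
    by apply/eqP; rewrite eqn_leq h_le1 size_poly_gt0.
  (* Modulo a nonzero constant the only residue is 0, and it is coprime to that constant. *)
  exists [:: 0]; rewrite size_h expn0; split=> // g; rewrite inE => /eqP->.
  by rewrite size_poly0 /= coprimep_def gcd0p size_h.
(* A nonconstant divisor of least size is irreducible. Ranging over coefficient vectors makes the
   search finite, hence decidable. *)
have exf : exists d, [exists v : 'rV[F]_(size h),
    [&& rVpoly v %| h, size (rVpoly v) == d & (1 < d)%N]].
  exists (size h); apply/existsP; exists (poly_rV h).
  by rewrite poly_rV_K // dvdpp eqxx.
case: (ex_minnP exf) => d /existsP[v /and3P[]] fh /eqP size_f d_gt1 d_min.
pose f : {poly F} := rVpoly v; rewrite -/f in fh size_f.
have f_neq0 : f != 0 by rewrite -size_poly_gt0 size_f ltnW.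
have f_irr : irreducible_poly f.
  split=> [|g g_neq1 gf]; first by rewrite size_f.
  have g_neq0 : g != 0 by apply: dvdpN0 gf f_neq0.
  have gh : g %| h by apply: dvdp_trans gf fh.
  rewrite -dvdp_size_eqp // eqn_leq dvdp_leq //= size_f; apply: d_min.
  apply/existsP; exists (poly_rV g); rewrite poly_rV_K ?dvdp_leq // gh eqxx /=.
  by rewrite ltn_neqAle eq_sym g_neq1 size_poly_gt0.
case/dvdpP: fh => h1 h_eq.
have h1_neq0 : h1 != 0 by apply: contraNneq h_neq0 => h10; rewrite h_eq h10 mul0r.
have [c size_h1] : exists c, size h1 = c.+1.
  by exists (size h1).-1; rewrite prednK // size_poly_gt0.
have size_h : size h = (c + d)%N by rewrite h_eq size_mul // size_f size_h1.
rewrite size_h in lt_hk *.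
have [|//|l1 [l1_uniq l1_cop l1_size]] := IH h1; first by rewrite size_h1; lia.
rewrite size_h1 /= in l1_cop l1_size.
pose U : seq {poly F} := [seq rVpoly v | v <- enum 'rV[F]_(d.-1)].
have size_U u : u \in U -> (size u < d)%N.
  move=> /mapP[w _ ->]; apply: leq_ltn_trans (size_poly _ _) _; lia.
have U_uniq : uniq U.
  by rewrite map_inj_uniq ?enum_uniq //; apply: can_inj (@rVpolyK _ _).
pose bad (g : {poly F}) : pred {poly F} := fun u => f %| g + u * h1.
pose W g := [seq u <- U | ~~ bad g u].
have size_W g : g \in l1 -> ((#|F| - 1) ^ d.-1 <= size (W g))%N.
  move=> /l1_cop /andP[_ g_cop].
  have size_U' : size U = (#|F| ^ d.-1)%N.
    by rewrite size_map -cardE card_mx mul1n.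
  have bad_le1 : (count (bad g) U <= 1)%N.
    rewrite -size_filter.
    have := filter_uniq (bad g) U_uniq.
    have in_bad u : u \in [seq u <- U | bad g u] ->
        (size u < d)%N /\ f %| g + u * h1.
      by rewrite mem_filter => /andP[? /size_U].
    case: [seq _ <- _ | _] in_bad => [|u [|w s]] // in_bad.
    have [u_lt fu] := in_bad u (mem_head _ _).
    have [|w_lt fw] := in_bad w; first by rewrite !inE eqxx orbT.
    rewrite /= inE negb_or -andbA => /and3P[/eqP[]].
    have f_uw : f %| (u - w) * h1.
      have -> : (u - w) * h1 = (g + u * h1) - (g + w * h1) by ring.
      exact: dvdp_sub.
    (* If [f] divided [h1], a bad [u] would make [f] a common factor of [g] and [h1]. *)
    have f_cop : coprimep f h1.
      rewrite irreducible_poly_coprime //; apply/negP => fh1.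
      have fg : f %| g by rewrite -(dvdp_addl _ (dvdp_mull u fh1)).
      have := dvdp_gcd f g h1; rewrite fg fh1 => /dvdp_leq.
      move: g_cop; rewrite coprimep_def => /eqP size1.
      rewrite -size_poly_eq0 size1 size_f => /(_ isT); lia.
    rewrite Gauss_dvdpl // in f_uw; apply/eqP; rewrite -subr_eq0.
    apply: contraTT f_uw => uw_neq0; apply/negP=> /(dvdp_leq uw_neq0).
    rewrite size_f leqNgt; case/negP.
    by apply: leq_ltn_trans (size_polyD _ _) _; rewrite size_polyN gtn_max u_lt.
  rewrite size_filter -(count_predC (bad g) U) in size_U' *.
  (* The strict inequality pays for the one bad [u]. *)
  have : ((#|F| - 1) ^ d.-1 < #|F| ^ d.-1)%N.
    rewrite ltn_exp2r; last by lia.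
    by rewrite ltn_subrL /= ltnW //; apply: finNzRing_gt1.
  rewrite -size_U' => /leq_trans lt_exp; rewrite -ltnS; apply: lt_exp.
  by rewrite -addn1 addnC leq_add2l.
exists [seq g + u * h1 | g <- l1, u <- W g]; split.
- apply: allpairs_uniq_dep => //; first by move=> g _; apply: filter_uniq.
  move=> [g u] [g' u'] /= /allpairsPdep[g1 [u1 [g1l _ [-> ->]]]].
  move=> /allpairsPdep[g2 [u2 [g2l _ [-> ->]]]] /= eq_gu.
  (* The pair is recovered from the sum: [g] is its remainder modulo [h1]. *)
  have mod_g g3 u3 : g3 \in l1 -> (g3 + u3 * h1) %% h1 = g3.
    move=> /l1_cop/andP[lt _]; rewrite modpD modp_mull addr0.
    by rewrite modp_small ?size_h1.
  have eg : g1 = g2 by rewrite -(mod_g g1 u1) // eq_gu mod_g.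
  by move: eq_gu; rewrite eg => /addrI /(mulIf h1_neq0) ->.
- move=> g /allpairsPdep[g1 [u1 [g1l]]]; rewrite mem_filter => /andP[nf u1U] ->.
  have /andP[lt_g1 g1_cop] := l1_cop _ g1l.
  apply/andP; split.
    apply: leq_ltn_trans (size_polyD _ _) _; rewrite gtn_max.
    apply/andP; split; first by apply: leq_trans lt_g1 _; lia.
    have [->|u1_neq0] := eqVneq u1 0; first by rewrite mul0r size_poly0; lia.
    rewrite size_mul // size_h1 addnS /= addnC ltn_add2l; exact: size_U.
  rewrite h_eq coprimepMr; apply/andP; split.
    by rewrite -coprimep_modl modpD modp_mull addr0 coprimep_modl.
  by rewrite coprimep_sym irreducible_poly_coprime.
- rewrite size_allpairs_dep (_ : (c + d).-1 = c + d.-1)%N ?expnD; last by lia.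
  apply: leq_trans (leq_mul l1_size (leqnn _)) _.
  rewrite mulnC -sum1_size big_distrr /= sumnE big_map big_seq [leqRHS]big_seq.
  by apply: leq_sum => g /size_W; rewrite muln1.
Qed.

Lemma card_finvect (F : finFieldType) (L : fieldExtType F) :
  #|finvect_type L| = (#|F| ^ \dim {:L})%N.
Proof.
rewrite -(@card_vspacef F (finvect_type L) (Vector.class (finvect_type L))).
exact: card_vspace.
Qed.

(** * The polynomial action through the Frobenius *)

Section FrobeniusAction.

Variables (F : finFieldType) (L : fieldExtType F).
Let q := #|F|.
Let n := \dim {:L}.

Lemma frobD (x y : L) : (x + y) ^+ q = x ^+ q + y ^+ q.
Proof.
have [p p_pr pF] := finPcharP F.
have pL : p \in [pchar L] by rewrite pchar_lalg.
apply: exprDn_pchar; rewrite (eq_pnat _ (pcharf_eq pL)) /q.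
by rewrite (card_pprimeChar pF) pnatX pnat_id.
Qed.

Lemma frobZ (c : F) (x : L) : (c *: x) ^+ q = c *: x ^+ q.
Proof. by rewrite exprZn expf_card. Qed.

Lemma frob_card (x : L) : x ^+ (q ^ n) = x.
Proof.
by rewrite -card_finvect; apply: (@expf_card (finvect_type L)).
Qed.

(** The linearized polynomial associated with [p], evaluated at [x]. This is the [F[X]]-module
    structure on [L] in which [X] acts as the [q]-Frobenius. *)
Definition frob_eval (p : {poly F}) (x : L) : L :=
  \sum_(i < size p) p`_i *: x ^+ (q ^ i).

Lemma frob_eval_widen (m : nat) (p : {poly F}) (x : L) : (size p <= m)%N ->
  frob_eval p x = \sum_(i < m) p`_i *: x ^+ (q ^ i).
Proof.
move=> le_pm; rewrite /frob_eval (big_ord_widen _ (fun i => p`_i *: x ^+ (q ^ i)) le_pm).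
rewrite [RHS](bigID (fun i : 'I_m => (i < size p)%N)) /= [X in _ = _ + X]big1 ?addr0 //.
by move=> i; rewrite -leqNgt => le; rewrite nth_default // scale0r.
Qed.

Lemma frob_evalD (p r : {poly F}) (x : L) :
  frob_eval (p + r) x = frob_eval p x + frob_eval r x.
Proof.
pose m := maxn (size p) (size r).
rewrite !(@frob_eval_widen m) ?leq_maxl ?leq_maxr ?size_polyD // -big_split /=.
by apply: eq_bigr => i _; rewrite coefD scalerDl.
Qed.

Lemma frob_evalC (c : F) (x : L) : frob_eval c%:P x = c *: x.
Proof.
rewrite (@frob_eval_widen 1) ?size_polyC ?leq_b1 // big_ord1 coefC eqxx.
by rewrite expn0 expr1.
Qed.

Lemma frob_eval0 (x : L) : frob_eval 0 x = 0.
Proof. by rewrite -polyC0 frob_evalC scale0r. Qed.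

Lemma frob_evalMX (p : {poly F}) (x : L) :
  frob_eval (p * 'X) x = frob_eval p x ^+ q.
Proof.
have -> : frob_eval p x ^+ q = \sum_(i < size p) p`_i *: x ^+ (q ^ i.+1).
  rewrite /frob_eval (big_morph (fun z : L => z ^+ q) frobD (_ : 0 ^+ q = 0)).
    by apply: eq_bigr => i _; rewrite frobZ -exprM -expnSr.
  by rewrite expr0n (negPf (_ : q != 0%N)) // -lt0n; apply/card_gt0P; exists 0.
rewrite (@frob_eval_widen (size p).+1).
  rewrite big_ord_recl coefMX scale0r add0r.
  by apply: eq_bigr => i _; rewrite coefMX.
by apply: leq_trans (size_polyMleq _ _) _; rewrite size_polyX addn2.
Qed.

Lemma frob_evalZ (c : F) (p : {poly F}) (x : L) :
  frob_eval (c%:P * p) x = c *: frob_eval p x.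
Proof.
rewrite (@frob_eval_widen (size p)).
  rewrite /frob_eval scaler_sumr.
  by apply: eq_bigr => i _; rewrite coefCM scalerA.
by apply: leq_trans (size_polyMleq _ _) _; rewrite size_polyC; case: (c == 0); lia.
Qed.

Lemma frob_evalM (p r : {poly F}) (x : L) :
  frob_eval (p * r) x = frob_eval p (frob_eval r x).
Proof.
elim/poly_ind: p => [|p c IH]; first by rewrite mul0r !frob_eval0.
rewrite mulrDl !frob_evalD frob_evalZ frob_evalC mulrAC !frob_evalMX IH.
by [].
Qed.

Lemma frob_evalX (i : nat) (x : L) : frob_eval 'X^i x = x ^+ (q ^ i).
Proof.
elim: i => [|i IH]; first by rewrite expr0 -polyC1 frob_evalC scale1r expn0 expr1.
by rewrite exprSr frob_evalMX IH -exprM -expnSr.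
Qed.

Lemma frob_eval_in_span (p : {poly F}) (x : L) :
  frob_eval p x \in frob_span q n x.
Proof.
rewrite /frob_eval; apply: memv_suml => i _; apply: memvZ; apply: memv_span.
(* Since [x^(q^n) = x], Frobenius exponents only matter modulo [n]. *)
have -> : x ^+ (q ^ i) = x ^+ (q ^ (i %% n)).
  rewrite {1}(divn_eq i n) expnD exprM; congr (_ ^+ _).
  elim: (i %/ n)%N => [|j IH]; first by rewrite mul0n expn0 expr1.
  by rewrite mulSn expnD exprM frob_card.
apply/mapP; exists (i %% n)%N => //.
by rewrite mem_iota add0n /= ltn_mod adim_gt0.
Qed.

(** The Frobenius span is the submodule generated by the element, and here [x] and [p.x] are
    multiples of each other. *)
Lemma frob_span_frob_eval (p r : {poly F}) (x : L) :
  frob_eval r (frob_eval p x) = x ->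
  frob_span q n (frob_eval p x) = frob_span q n x.
Proof.
move=> rpx; apply/eqP; rewrite eqEsubv; apply/andP; split.
  apply/span_subvP => _ /mapP[i _ ->].
  by rewrite -frob_evalX -frob_evalM frob_eval_in_span.
apply/span_subvP => _ /mapP[i _ ->].
by rewrite -frob_evalX -{1}rpx -frob_evalM frob_eval_in_span.
Qed.

(** Let [h] be the annihilator of [x] of least degree. Residues [g] modulo [h] give distinct [g.x];
    those coprime to [h] act invertibly on [x] and preserve its span, whose dimension [n - k] is at
    most [deg h]. *)
Lemma count_k_normal (k : nat) (x : L) : k_normal q n k x ->
  exists l : seq L, [/\ uniq l, {in l, forall y, k_normal q n k y}
    & ((q - 1) ^ (n - k) <= size l)%N].
Proof.
move=> x_normal.
have n_gt0 : (0 < n)%N by apply: adim_gt0.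
(* Annihilators exist with size at most [n + 1], since [X^n - 1] is one. *)
have exh : exists d, [exists v : 'rV[F]_n.+1,
    [&& rVpoly v != 0, size (rVpoly v) == d & frob_eval (rVpoly v) x == 0]].
  have size_h : size ('X^n - 1 : {poly F}) = n.+1 by rewrite size_XnsubC.
  exists n.+1; apply/existsP; exists (poly_rV ('X^n - 1)).
  rewrite poly_rV_K ?size_h // eqxx -size_poly_gt0 size_h /=.
  rewrite frob_evalD frob_evalX frob_card (_ : -1 = (-1)%:P) ?frob_evalC.
    by rewrite scaleN1r subrr.
  by rewrite polyCN.
case: (ex_minnP exh) => d /existsP[v /and3P[]] h_neq0 /eqP size_h hx d_min.
pose h : {poly F} := rVpoly v; rewrite -/h in h_neq0 size_h hx.
have h_min (p : {poly F}) : frob_eval p x = 0 -> (size p < d)%N -> p = 0.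
  move=> px lt_pd; apply/eqP; apply: contraTT lt_pd => p_neq0; rewrite -leqNgt.
  have [le_pn|lt_np] := leqP (size p) n.+1.
    apply: d_min; apply/existsP; exists (poly_rV p).
    by rewrite poly_rV_K // p_neq0 eqxx px /=.
  by apply: leq_trans (ltnW lt_np); rewrite -size_h; apply: size_poly.
(* [d] is the size of [h], so its degree is [d.-1]; reducing [X^i] modulo [h] shows that the first
   [d.-1] conjugates span. *)
have dim_le : (n - k <= d.-1)%N.
  rewrite -x_normal; set X := [seq x ^+ (q ^ i) | i <- iota 0 d.-1].
  apply: leq_trans (_ : \dim <<X>> <= _)%N; last first.
    by apply: leq_trans (dim_span _) _; rewrite size_map size_iota.
  apply/dimvS/span_subvP => _ /mapP[i _ ->]; rewrite -frob_evalX.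
  rewrite (divp_eq 'X^i h) frob_evalD frob_evalM (eqP hx) -(frob_eval0 x).
  rewrite -frob_evalM mulr0 frob_eval0 add0r.
  apply: memv_suml => j _; apply: memvZ; apply: memv_span; apply/mapP.
  exists (nat_of_ord j) => //; rewrite mem_iota add0n /=.
  have lt_d : (size (modp 'X^i h) < d)%N by rewrite -size_h ltn_modp.
  apply: leq_trans (ltn_ord j) _.
  by rewrite -ltnS prednK // (leq_trans _ lt_d).
have [l [l_uniq l_cop l_size]] := count_coprime_poly h_neq0.
exists [seq frob_eval g x | g <- l]; split.
- rewrite map_inj_in_uniq // => g g' /l_cop/andP[lt_g _] /l_cop/andP[lt_g' _] eq_g.
  apply/eqP; rewrite -subr_eq0; apply/eqP/h_min.
    by rewrite frob_evalD eq_g -frob_evalD subrr frob_eval0.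
  apply: leq_ltn_trans (size_polyD _ _) _.
  by rewrite size_polyN gtn_max -size_h lt_g.
- move=> _ /mapP[g /l_cop/andP[_ /Bezout_coprimepP[[u w] /= uw1]] ->].
  (* Coprimality gives the Bezout identity only up to a nonzero constant [c]; [u / c] then inverts
     [g] on [x], because [h] kills [x]. *)
  have [c c_neq0 uw_eq] : exists2 c : F, c != 0 & u * g + w * h = c%:P.
    move: uw1; rewrite -size_poly_eq1 => /size_poly1P[c c_neq0 ->]; by exists c.
  rewrite /k_normal (@frob_span_frob_eval g (c^-1%:P * u)) // -frob_evalM.
  have -> : c^-1%:P * u * g = 1 - c^-1%:P * w * h.
    rewrite -!mulrA -[u * g](addrK (w * h)) uw_eq mulrBr -polyCM mulVf //.
  rewrite frob_evalD -mulNr frob_evalM (eqP hx) -(frob_eval0 x) -frob_evalM.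
  by rewrite mulr0 frob_eval0 addr0 -polyC1 frob_evalC scale1r.
- rewrite size_map; apply: leq_trans l_size; rewrite size_h.
  rewrite leq_pexp2l // subn_gt0; exact: finNzRing_gt1.
Qed.

End FrobeniusAction.

(** * A k-normal element of large order *)

Lemma k_normal0 (F : finFieldType) (L : fieldExtType F) (n k : nat) :
  (k < n)%N -> ~ k_normal #|F| n k (0 : L).
Proof.
move=> lt_kn dim_eq; suff : (\dim (frob_span #|F| n (0 : L)) <= 0)%N.
  by rewrite dim_eq leqn0 subn_eq0 leqNgt lt_kn.
apply: leq_trans (dimvS (_ : _ <= 0)%VS) _; last by rewrite dimv0.
apply/span_subvP => _ /mapP[i _ ->].
rewrite expr0n expn_eq0 -leqn0 leqNgt ltnW ?mem0v //; exact: finNzRing_gt1.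
Qed.

(** Take [a] of largest order in the set [B] of counted elements. Then [|B| |G|] is the sum of
    [ord(b) (|G| / ord(b))] over [B], at most [ord(a)] times the sum of all indices. *)
Lemma exists_k_normal_large_order (F : finFieldType) (L : fieldExtType F)
    (k : nat) (x : L) :
  let q := #|F| in let n := \dim {:L}%VS in
  (k < n)%N -> k_normal q n k x ->
  exists a : {unit finvect_type L}, k_normal q n k (FinRing.uval a) /\
    ((q - 1) ^ (n - k) * (q ^ n - 1) <= #[a]%g * pillai (q ^ n - 1))%N.
Proof.
move=> q n lt_kn x_normal.
have [l [l_uniq l_normal l_size]] := count_k_normal x_normal.
pose val_unit (a : {unit finvect_type L}) : L := FinRing.uval a.
pose B := [set a | val_unit a \in l].
have card_B : #|B| = size l.
  have -> : #|B| = size [seq val_unit a | a <- enum B].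
    by rewrite size_map cardE.
  apply: perm_size; apply: uniq_perm => //.
    rewrite map_inj_uniq ?enum_uniq //; exact: val_inj.
  move=> y; apply/mapP/idP => [[a]|yl]; first by rewrite mem_enum inE => al ->.
  have y_neq0 : (y : finvect_type L) != 0.
    by apply/eqP => y0; have := l_normal y yl; rewrite [y]y0; apply: k_normal0.
  have y_unit : (y : finvect_type L) \is a GRing.unit by rewrite unitfE.
  by exists (FinRing.unit _ y_unit) => //; rewrite mem_enum inE.
have q_gt1 : (1 < q)%N by apply: finNzRing_gt1.
have B_gt0 : (0 < #|B|)%N.
  by rewrite card_B; apply: leq_trans l_size; rewrite expn_gt0 subn_gt0 q_gt1.
have [b0 b0B] := card_gt0P B_gt0.
pose a := [arg max_(b > b0 in B) #[b]%g]%N.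
have [aB a_max] : a \in B /\ forall b, b \in B -> (#[b]%g <= #[a]%g)%N.
  by rewrite /a; case: arg_maxnP.
exists a; split; first by apply: l_normal; move: aB; rewrite inE.
pose G := [set: {unit finvect_type L}]%G.
have card_G : #|G| = (q ^ n - 1)%N by rewrite card_finField_unit card_finvect subn1.
rewrite -card_G.
apply: leq_trans (_ : #|B| * #|G| <= _)%N.
  by rewrite leq_mul2r card_B l_size orbT.
apply: leq_trans (_ : #[a]%g * \sum_(b in B) (#|G| %/ #[b]%g) <= _)%N; last first.
  rewrite leq_mul2l; apply/orP; right.
  apply: leq_trans (sum_card_div_order_cyclic (field_unit_group_cyclic G)).
  rewrite [leqRHS](bigID (mem B)) /=; apply: leq_trans (leq_addr _ _).
  by rewrite [leqRHS](eq_bigl (fun b => b \in B)) // => b; rewrite inE.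
rewrite -sum_nat_const big_distrr /=; apply: leq_sum => b bB.
have {1}-> : #|G| = (#[b]%g * (#|G| %/ #[b]%g))%N.
  by rewrite mulnC divnK // order_dvdG // inE.
by rewrite leq_mul2r a_max ?orbT.
Qed.

End CountKNormal.

(** * Bounds for prime powers *)

Lemma pfactor_term_le (p a : nat) : p + a * (p - 1) <= p * a.+1.
Proof. nia. Qed.

Lemma leq_expl (m x y : nat) : x <= y -> x ^ m <= y ^ m.
Proof. by move=> le_xy; case: m => // m; rewrite leq_exp2r. Qed.

(** As [1 + a <= 2^a] and [2^m <= p], primes from [2^m] on cost nothing. *)
Lemma pfactor_bound_large (m p a : nat) : 2 ^ m <= p ->
  (p + a * (p - 1)) ^ m <= p ^ (m + a).
Proof.
move=> le_p; apply: leq_trans (_ : (p * 2 ^ a) ^ m <= _).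
  apply/leq_expl/(leq_trans (pfactor_term_le _ _)).
  by rewrite leq_mul2l ltn_expl ?orbT.
by rewrite expnMn expnD -expnM mulnC [a * m]mulnC expnM mulnC leq_mul2l leq_expl ?orbT.
Qed.

(* Uses [1 + a <= 2 (3/2)^(a-1)], an equality at [a = 1, 2]. *)
Lemma pfactor_bound_middle (m p a : nat) :
  3 ^ m <= 2 ^ m * p -> p < 2 ^ m -> 1 < p -> 0 < a ->
  (p + a * (p - 1)) ^ m <= 2 ^ (m - trunc_log 2 p) * p ^ (m + a).
Proof.
move=> le_3m lt_p p_gt1; case: a => // a _.
apply: leq_trans (leq_expl _ (pfactor_term_le _ _)) _.
rewrite expnMn expnD mulnCA leq_mul2l; apply/orP; right.
have le_a : (a.+2) * 2 ^ a <= 2 * 3 ^ a.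
  elim: a => // a; rewrite !expnS; have := expn_gt0 3 a; have := expn_gt0 2 a; nia.
have le_am : (a.+2) ^ m <= 2 ^ m * p ^ a.
  rewrite -(leq_pmul2r (m := (2 ^ m) ^ a)) ?expn_gt0 // -mulnA -expnMn [p * _]mulnC.
  apply: leq_trans (_ : 2 ^ m * (3 ^ m) ^ a <= _); last first.
    by rewrite leq_mul2l leq_expl ?orbT.
  by rewrite -!expnM ![m * a]mulnC !expnM -!expnMn leq_expl.
have le_l : 2 ^ trunc_log 2 p <= p by apply: trunc_logP; lia.
have le_lm : trunc_log 2 p <= m.
  by rewrite -(leq_exp2l (m := 2)) //; apply: leq_trans le_l (ltnW lt_p).
(* The spare factor [p] absorbs [2^(trunc_log 2 p)] out of [2^m]. *)
apply: (leq_trans le_am); rewrite -{1}(subnK le_lm) expnD -mulnA expnS.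
by rewrite leq_mul2l leq_mul2r le_l !orbT.
Qed.

(* With [t = a %/ m]: [1 + a <= m (t + 1) <= m 2^t], and [m t <= a]. *)
Lemma pfactor_bound_crude (m p a : nat) : 1 < p -> 0 < m ->
  (p + a * (p - 1)) ^ m <= m ^ m * p ^ (m + a).
Proof.
move=> p_gt1 m_gt0; apply: leq_trans (leq_expl _ (pfactor_term_le _ _)) _.
rewrite expnMn expnD mulnCA leq_mul2l; apply/orP; right.
apply: leq_trans (_ : (m * 2 ^ (a %/ m)) ^ m <= _).
  apply: leq_expl; apply: leq_trans (_ : m * (a %/ m).+1 <= _).
    by rewrite mulnC ltn_ceil.
  by rewrite leq_mul2l ltn_expl ?orbT.
rewrite expnMn leq_mul2l -expnM; apply/orP; right.
apply: leq_trans (_ : 2 ^ a <= _); last exact: leq_expl.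
by rewrite leq_exp2l // leq_trunc_div.
Qed.

(** Beyond 2, at most one of two consecutive integers is prime; the induction carries [T] and
    [T + 1] together so as to advance by two. *)
Lemma count_prime_half (T : nat) : \sum_(p < T | prime p) 1 <= T./2.
Proof.
suff [] : \sum_(p < T | prime p) 1 <= T./2 /\
          \sum_(p < T.+1 | prime p) 1 <= T.+1./2 by [].
elim: T => [|T [IH1 IH2]].
  by split; [rewrite big_ord0 | rewrite big_mkcond big_ord_recr big_ord0].
split=> //.
have [T_le|T_gt] := leqP T 2.
  by case: T T_le {IH1 IH2} => [|[|[|T]]] //= _;
    rewrite big_mkcond !big_ord_recr big_ord0.
rewrite big_mkcond !big_ord_recr /= -big_mkcond /=.
have : (prime T : nat) + prime T.+1 <= 1.
  have [pT|] := boolP (prime T); last by case: (prime T.+1).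
  have [pT1|//] := boolP (prime T.+1).
  by case: (even_prime pT) (even_prime pT1) => [|/= ->] [] //; lia.
by move: IH1; case: (prime T); case: (prime T.+1); rewrite /=; lia.
Qed.

(** Raising [m] by one adds at most 1 for each prime below [2^(m+1)], and there are at most [2^m] of
    these; primes from [2^m] on contributed 0 before. *)
Lemma sum_prime_log (m : nat) :
  \sum_(p < 2 ^ m | prime p) (m - trunc_log 2 p) <= 2 ^ m.
Proof.
elim: m => [|m IH]; first by rewrite big_mkcond big_ord_recr big_ord0.
have le_2 : 2 ^ m <= 2 ^ m.+1 by rewrite leq_exp2l.
apply: leq_trans (_ : \sum_(p < 2 ^ m.+1 | prime p) ((m - trunc_log 2 p) + 1) <= _).
  by apply: leq_sum => p _; lia.
rewrite big_split /= [leqRHS]expnS mul2n -addnn.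
apply: leq_add; last first.
  by apply: leq_trans (count_prime_half _) _; rewrite expnS mul2n doubleK.
apply: leq_trans IH.
rewrite -(big_mkord (fun p => prime p) (fun p => m - trunc_log 2 p)).
rewrite -(big_mkord (fun p => prime p) (fun p => m - trunc_log 2 p)).
rewrite (big_cat_nat (n := 2 ^ m)) //= [X in _ + X]big1_seq ?addn0 //.
move=> p /andP[_]; rewrite mem_index_iota => /andP[le_p _].
apply/eqP; rewrite subn_eq0 -(trunc_expnK m (isT : 1 < 2)).
exact: leq_trunc_log.
Qed.

(** Three ranges of primes: below [T] the bound [small] is supplied, from [T >= (3/2)^m] up to [2^m]
    the middle bound applies, and beyond that the loss is zero. *)
Lemma pillai_pow_le (m s T E : nat) (small : nat -> nat) :
  (forall p a, prime p -> p < T -> 0 < a ->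
     (p + a * (p - 1)) ^ (m * s) <= 2 ^ small p * p ^ (m * s + s * a)) ->
  3 ^ m <= 2 ^ m * T ->
  \sum_(p < T | prime p) small p + (if T < 2 ^ m then s * 2 ^ m else 0) <= E ->
  forall N, 0 < N -> pillai N ^ (m * s) <= 2 ^ E * N ^ (m * s + s).
Proof.
move=> small_bound le_T le_E N N_gt0.
pose e p := if p < T then small p else
            if p < 2 ^ m then s * (m - trunc_log 2 p) else 0.
have e_bound p a : prime p -> 0 < a ->
    (p + a * (p - 1)) ^ (m * s) <= 2 ^ e p * p ^ (m * s + s * a).
  move=> p_pr a_gt0; rewrite /e; case: ltnP => [lt_p|le_p]; first exact: small_bound.
  rewrite [s * a]mulnC -mulnDl !expnM; case: ltnP => lt_p; last first.
    by rewrite mul1n leq_expl // pfactor_bound_large.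
  rewrite [s * _]mulnC expnM -expnMn leq_expl // pfactor_bound_middle ?prime_gt1 //.
  by apply: leq_trans le_T _; rewrite leq_mul2l le_p orbT.
apply: leq_trans (pillai_bound e_bound N_gt0) _.
rewrite leq_mul2r leq_exp2l //; apply/orP; right.
apply: leq_trans le_E.
have e_split p : e p = (if p < T then small p else 0) +
    (if T <= p < 2 ^ m then s * (m - trunc_log 2 p) else 0).
  by rewrite /e; case: ltnP => //=; rewrite addn0.
rewrite (eq_bigr _ (fun p _ => e_split p)) big_split /=; apply: leq_add.
  rewrite -big_mkcond -(big_mkord (fun p => prime p) small) /=.
  apply: uniq_sub_le_big_cond; rewrite ?filter_uniq ?primes_uniq ?iota_uniq //.
    by move=> x y; apply: leq_addr.
  move=> p; rewrite !mem_filter mem_primes mem_index_iota /=.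
  by move=> /and3P[-> -> _].
case: ltnP => lt_T; last first.
  rewrite big1 // => p _; case: ifP => // /andP[le_p lt_p].
  by have := leq_trans lt_T le_p; rewrite leqNgt lt_p.
rewrite -big_mkcond /=.
apply: leq_trans (_ : s * \sum_(p < 2 ^ m | prime p) (m - trunc_log 2 p) <= _).
  rewrite big_distrr /=.
  rewrite -(big_mkord (fun p => prime p) (fun p => s * (m - trunc_log 2 p))) /=.
  apply: uniq_sub_le_big_cond; rewrite ?filter_uniq ?primes_uniq ?iota_uniq //.
    by move=> x y; apply: leq_addr.
  move=> p; rewrite !mem_filter mem_primes mem_index_iota /=.
  by move=> /andP[/andP[_ ->] /and3P[-> _ _]].
by rewrite leq_mul2l sum_prime_log orbT.
Qed.

(** Here [T] is the floor of [(3/2)^m] plus 1, and each of the at most [T/2] primes below it is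
    charged [c] bits. *)
Lemma pillai_pow_le_crude (m c : nat) : 0 < m -> m ^ m <= 2 ^ c ->
  forall N, 0 < N ->
  pillai N ^ m <= 2 ^ (c * (3 ^ m %/ 2 ^ m).+1./2 + 2 ^ m) * N ^ m.+1.
Proof.
move=> m_gt0 le_c N N_gt0.
have := @pillai_pow_le m 1 (3 ^ m %/ 2 ^ m).+1
  (c * (3 ^ m %/ 2 ^ m).+1./2 + 2 ^ m) (fun=> c) _ _ _ N N_gt0.
rewrite !muln1 addn1; apply.
- move=> p a p_pr _ a_gt0; rewrite mul1n.
  apply: leq_trans (pfactor_bound_crude _ (prime_gt1 p_pr) m_gt0) _.
  by rewrite leq_mul2r le_c orbT.
- by rewrite mulnC ltnW // ltn_ceil ?expn_gt0.
- apply: leq_add; last by case: ifP; rewrite ?mul1n.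
  apply: leq_trans (_ : c * \sum_(p < (3 ^ m %/ 2 ^ m).+1 | prime p) 1 <= _).
    by rewrite big_distrr /= muln1.
  by rewrite leq_mul2l count_prime_half orbT.
Qed.

(** * A finite computation for the small primes *)

Section Certificate.
Local Open Scope N_scope.

(* The least [e] such that [(p + a(p-1))^M <= 2^e p^(M + s a)]. *)
Definition ratio_bits (M s p a : N) : N :=
  N.log2_up (((p + a * (p - 1)) ^ M - 1) / p ^ (M + s * a) + 1).

Fixpoint max_bits (M s p : N) (A : nat) : N :=
  if A is A'.+1 then N.max (ratio_bits M s p (N.of_nat A)) (max_bits M s p A') else 0.

(** [(1 + 1/A)^m <= p] holds once [A >= m / ln p], and [1 / ln 2 < 2]. *)
Definition last_index (m p : N) : nat := N.to_nat (2 * m / N.log2 p + 1).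

(* Guarantees that the ratio in [ratio_bits] decreases from [a = A] on. *)
Definition tail_ok (M s p : N) (A : nat) : bool :=
  (N.of_nat A + 1) ^ M <=? p ^ s * N.of_nat A ^ M.

(* Only a superset of the primes is needed. *)
Definition rough (p : N) : bool :=
  all (fun d => (p =? d) || ~~ (p mod d =? 0)) [:: 2; 3; 5; 7].

Definition candidates (T : nat) : seq N :=
  [seq p <- [seq N.of_nat p | p <- iota 2 (T - 2)] | rough p].

(* With [M = m s] the exponents are counted in units of [1/s] bit; the finer
   units are needed for [m = 3, 4, 5]. *)
Definition certificate (m s T : nat) (E : N) : bool :=
  let m' := N.of_nat m in let s' := N.of_nat s in
  let M := m' * s' in
  all (fun p => tail_ok M s' p (last_index m' p)) (candidates T) &&
  (foldr (fun p acc => max_bits M s' p (last_index m' p) + acc) 0 (candidates T)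
     <=? E).

End Certificate.

Lemma of_nat_expn (x k : nat) : N.of_nat (x ^ k) = (N.of_nat x ^ N.of_nat k)%num.
Proof.
elim: k => [|k IH]; first by [].
by rewrite expnS Nat2N.inj_mul IH Nat2N.inj_succ N.pow_succ_r'.
Qed.

(** [(X - 1) / Y + 1] is the ceiling of [X / Y] for positive [X], and [N.log2_up] rounds upwards. *)
Lemma ratio_bitsP (M s p a : nat) : 0 < p ->
  (p + a * (p - 1)) ^ M <=
  2 ^ N.to_nat (ratio_bits (N.of_nat M) (N.of_nat s) (N.of_nat p) (N.of_nat a))
    * p ^ (M + s * a).
Proof.
move=> p_gt0.
set e := ratio_bits _ _ _ _.
suff : (N.of_nat ((p + a * (p - 1)) ^ M) <=
        N.of_nat (2 ^ N.to_nat e * p ^ (M + s * a)))%num by lia.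
rewrite Nat2N.inj_mul !of_nat_expn N2Nat.id.
rewrite Nat2N.inj_add !Nat2N.inj_mul Nat2N.inj_add Nat2N.inj_mul.
have -> : N.of_nat (p - 1) = (N.of_nat p - 1)%num by lia.
rewrite /e /ratio_bits {e}.
set Y := (N.of_nat p ^ (_ + _))%num; set X := (_ ^ N.of_nat M)%num.
have Y_neq0 : Y <> 0%num by apply: N.pow_nonzero; lia.
set Q := ((X - 1) / Y)%num.
have le_Q : (Q + 1 <= 2 ^ N.log2_up (Q + 1))%num.
  by have [->|] := N.eq_dec Q 0; [|have := @N.log2_up_spec (Q + 1)]; lia.
have lt_X : (X - 1 < Y * N.succ Q)%num by apply: N.mul_succ_div_gt.
change (N.of_nat 2) with 2%num; nia.
Qed.

Lemma max_bitsS (M s p : N) (A : nat) :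
  max_bits M s p A.+1 = N.max (ratio_bits M s p (N.of_nat A.+1)) (max_bits M s p A).
Proof. by []. Qed.

Lemma max_bitsP (M s p A a : nat) : 0 < p -> 0 < a <= A ->
  (p + a * (p - 1)) ^ M <=
  2 ^ N.to_nat (max_bits (N.of_nat M) (N.of_nat s) (N.of_nat p) A) * p ^ (M + s * a).
Proof.
move=> p_gt0; elim: A => [|A IH] /andP[a_gt0 le_aA]; first by lia.
have [a_eq|a_neq] := eqVneq a A.+1.
  apply: leq_trans (ratio_bitsP M s a p_gt0) _.
  rewrite leq_mul2r leq_exp2l //; apply/orP; right.
  by rewrite a_eq max_bitsS; lia.
apply: leq_trans (IH _) _; first by lia.
by rewrite leq_mul2r leq_exp2l // max_bitsS; apply/orP; right; lia.
Qed.

(** For [a >= A], the step to [a + 1] multiplies the left base by at most [(A + 1)/A], while the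
    right side gains [p^s]. *)
Lemma tail_okP (M s p A e : nat) : 0 < p -> 0 < A ->
  tail_ok (N.of_nat M) (N.of_nat s) (N.of_nat p) A ->
  (p + A * (p - 1)) ^ M <= 2 ^ e * p ^ (M + s * A) ->
  forall a, A <= a -> (p + a * (p - 1)) ^ M <= 2 ^ e * p ^ (M + s * a).
Proof.
move=> p_gt0 A_gt0 /N.leb_spec0.
have -> : (N.of_nat A + 1 = N.of_nat A.+1)%num by lia.
rewrite -!of_nat_expn -Nat2N.inj_mul => tail.
have {}tail : A.+1 ^ M <= p ^ s * A ^ M by lia.
move=> base; elim=> [|a IH] le_Aa; first by have := base; have -> : A = 0 by lia.
have [<-//|A_neq] := eqVneq A a.+1.
have {}IH : (p + a * (p - 1)) ^ M <= 2 ^ e * p ^ (M + s * a) by apply: IH; lia.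
rewrite -(leq_pmul2r (m := A ^ M)) ?expn_gt0 ?A_gt0 //.
apply: leq_trans (_ : ((p + a * (p - 1)) * A.+1) ^ M <= _).
  by rewrite -expnMn leq_expl //; nia.
rewrite expnMn mulnS [s + _]addnC addnA [p ^ (_ + s)]expnD.
apply: leq_trans (leq_mul IH tail) _.
by rewrite !mulnA.
Qed.

Lemma rough_prime (p : nat) : prime p -> rough (N.of_nat p).
Proof.
move=> p_pr; rewrite /rough /= andbT.
have rough1 d : 1 < d -> (N.of_nat p =? N.of_nat d)%num ||
    ~~ (N.of_nat p mod N.of_nat d =? 0)%num.
  move=> d_gt1; apply/orP; have [->|neq] := eqVneq p d; [left|right].
    exact: N.eqb_refl.
  apply/negP => /N.eqb_spec mod0.
  have dp : d %| p.
    apply/dvdnP; exists (N.to_nat (N.of_nat p / N.of_nat d)).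
    by have := N.div_mod (N.of_nat p) (N.of_nat d); nia.
  have d_neq1 : d != 1 by lia.
  by move/(prime_nt_dvdP p_pr d_neq1): dp neq => ->; rewrite eqxx.
by rewrite (rough1 2) ?(rough1 3) ?(rough1 5) ?(rough1 7).
Qed.

(** Exponents up to [last_index] fall under the computed maximum, later ones under the decrease of
    the ratio. Summing over all [candidates] can only enlarge the total. *)
Lemma certificateP (m s T E : nat) :
  certificate m s T (N.of_nat E) -> 0 < s ->
  3 ^ m <= 2 ^ m * T ->
  forall N, 0 < N ->
  pillai N ^ (m * s) <=
    2 ^ (E + (if T < 2 ^ m then s * 2 ^ m else 0)) * N ^ (m * s + s).
Proof.
move=> /andP[/allP tails /N.leb_spec0 le_E] s_gt0 le_T.
set M := (_ * _)%num in tails le_E.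
pose A p := last_index (N.of_nat m) (N.of_nat p).
pose small p := N.to_nat (max_bits M (N.of_nat s) (N.of_nat p) (A p)).
have cand p : prime p -> p < T -> N.of_nat p \in candidates T.
  move=> p_pr lt_p; rewrite mem_filter rough_prime //=; apply: map_f.
  by rewrite mem_iota; have := prime_gt1 p_pr; lia.
have M_eq : M = N.of_nat (m * s) by rewrite Nat2N.inj_mul.
apply: (@pillai_pow_le m s T _ small) => //.
  move=> p a p_pr lt_p a_gt0; have p_gt0 := prime_gt0 p_pr.
  have A_gt0 : 0 < A p by rewrite /A /last_index; move: (_ / _)%num => x; lia.
  rewrite /small M_eq; have [le_aA|lt_Aa] := leqP a (A p).
    by apply: max_bitsP => //; rewrite a_gt0.
  apply: (@tail_okP _ _ _ (A p)) => //; last exact: ltnW.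
    by rewrite -M_eq; apply: tails; apply: cand.
  by apply: max_bitsP => //; rewrite A_gt0 leqnn.
rewrite leq_add2r.
apply: leq_trans (_ : \sum_(p <- iota 2 (T - 2) | rough (N.of_nat p)) small p <= _).
  rewrite -(big_mkord (fun p => prime p) small) /=.
  apply: uniq_sub_le_big_cond; rewrite ?filter_uniq ?iota_uniq //.
    by move=> x y; apply: leq_addr.
  move=> p; rewrite !mem_filter mem_iota mem_index_iota => /andP[p_pr /andP[_ lt_p]].
  by rewrite rough_prime //=; have := prime_gt1 p_pr; lia.
apply: leq_trans (_ : N.to_nat (foldr (fun p acc =>
    max_bits M (N.of_nat s) p (last_index (N.of_nat m) p) + acc)%num
    0%num (candidates T)) <= _); last by lia.
rewrite /candidates {cand tails le_E}.
elim: (iota _ _) => [|p r IH]; first by rewrite big_nil.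
rewrite big_cons /=; case: ifP => //= _.
by rewrite N2Nat.inj_add leq_add2l.
Qed.

(** * Real estimates *)

Lemma INR_expn (a b : nat) : INR (a ^ b)%N = (INR a ^ b)%R.
Proof.
elim: b => [|b IH]; first by [].
by rewrite expnS mult_INR IH.
Qed.

Lemma INR_leq (a b : nat) : (a <= b)%N -> (INR a <= INR b)%R.
Proof. by move=> /leP; apply: le_INR. Qed.

Section RealBounds.
Local Open Scope R_scope.

Lemma ln_mono (x y : R) : 0 < x -> x <= y -> ln x <= ln y.
Proof.
by move=> x_gt0 [lt_xy|->]; [apply/Rlt_le/ln_increasing | apply: Rle_refl].
Qed.

Lemma exp_mono (x y : R) : x <= y -> exp x <= exp y.
Proof. by move=> [lt_xy|->]; [apply/Rlt_le/exp_increasing | apply: Rle_refl]. Qed.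

(** Starting from [1 + x <= exp x] at a small [x], repeated doubling gives rational lower bounds;
    each decimal in the chains below is at most the square of the one before. *)
Lemma exp_double_ge (c c' x : R) : 0 <= c -> c <= exp x -> c' <= c * c ->
  c' <= exp (2 * x).
Proof.
move=> c_ge0 le_c le_c'; have -> : 2 * x = x + x by lra.
by rewrite exp_plus; have := exp_pos x; nra.
Qed.

Lemma exp1_ge : 27 / 10 <= exp 1.
Proof.
have h0 : 1 + / 128 <= exp (/ 128) by apply: exp_ineq1_le.
have h1 : 1.015686 <= exp (2 * / 128) by apply: (@exp_double_ge 1.0078125); lra.
have h2 := @exp_double_ge 1.015686 1.031618 _ ltac:(lra) h1 ltac:(lra).
have h3 := @exp_double_ge 1.031618 1.064235 _ ltac:(lra) h2 ltac:(lra).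
have h4 := @exp_double_ge 1.064235 1.132596 _ ltac:(lra) h3 ltac:(lra).
have h5 := @exp_double_ge 1.132596 1.282773 _ ltac:(lra) h4 ltac:(lra).
have h6 := @exp_double_ge 1.282773 1.645506 _ ltac:(lra) h5 ltac:(lra).
have h7 := @exp_double_ge 1.645506 2.7 _ ltac:(lra) h6 ltac:(lra).
by move: h7; have -> : 2 * (2 * (2 * (2 * (2 * (2 * (2 * / 128)))))) = 1 by lra; lra.
Qed.

Lemma expN1_ge : 36 / 100 <= exp (-1).
Proof.
have h0 : 1 + - / 128 <= exp (- / 128) by apply: exp_ineq1_le.
have h1 : 0.984435 <= exp (2 * - / 128) by apply: (@exp_double_ge 0.9921875); lra.
have h2 := @exp_double_ge 0.984435 0.969112 _ ltac:(lra) h1 ltac:(lra).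
have h3 := @exp_double_ge 0.969112 0.939178 _ ltac:(lra) h2 ltac:(lra).
have h4 := @exp_double_ge 0.939178 0.882055 _ ltac:(lra) h3 ltac:(lra).
have h5 := @exp_double_ge 0.882055 0.778021 _ ltac:(lra) h4 ltac:(lra).
have h6 := @exp_double_ge 0.778021 0.605316 _ ltac:(lra) h5 ltac:(lra).
have h7 := @exp_double_ge 0.605316 0.36 _ ltac:(lra) h6 ltac:(lra).
by move: h7; have -> : 2 * (2 * (2 * (2 * (2 * (2 * (2 * - / 128)))))) = -1 by lra; lra.
Qed.

Lemma exp1_lt3 : exp 1 < 3.
Proof.
have := expN1_ge; have := exp_pos 1.
have : exp 1 * exp (-1) = 1 by rewrite -exp_plus (_ : 1 + -1 = 0) ?exp_0; lra.
nra.
Qed.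

Lemma ln2_le : ln 2 <= 7 / 10.
Proof.
have h0 : 1 + 0.7 / 64 <= exp (0.7 / 64) by apply: exp_ineq1_le.
have h1 : 1.021994 <= exp (2 * (0.7 / 64)) by apply: (@exp_double_ge 1.0109375); lra.
have h2 := @exp_double_ge 1.021994 1.044471 _ ltac:(lra) h1 ltac:(lra).
have h3 := @exp_double_ge 1.044471 1.090919 _ ltac:(lra) h2 ltac:(lra).
have h4 := @exp_double_ge 1.090919 1.190104 _ ltac:(lra) h3 ltac:(lra).
have h5 := @exp_double_ge 1.190104 1.416347 _ ltac:(lra) h4 ltac:(lra).
have h6 := @exp_double_ge 1.416347 2 _ ltac:(lra) h5 ltac:(lra).
move: h6; have -> : 2 * (2 * (2 * (2 * (2 * (2 * (0.7 / 64)))))) = 7 / 10 by lra.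
by move=> le2; rewrite -(ln_exp (7 / 10)); apply: ln_mono; lra.
Qed.

Lemma exp_INR_ge (m : nat) : (27 / 10) ^ m <= exp (INR m).
Proof.
elim: m => [|m IH]; first by rewrite /= exp_0; lra.
rewrite S_INR exp_plus /= Rmult_comm.
by apply: Rmult_le_compat => //; [apply: pow_le; lra | lra | exact: exp1_ge].
Qed.

(* With [t = exp (x - m)] in [[1/e, 1]] and [x <= m - 1 + t], the inequality of
   [budgetP] follows from one quadratic in [t]; the two conditions are its values at
   [t = 1] and at [t = 36/100 < 1/e], with [exp m] replaced by [(27/10)^m]. *)
Definition budget (m : nat) (kappa : R) : Prop :=
  kappa <= 1 / 10 * (27 / 10) ^ m /\
  kappa * (INR m - 64 / 100) <= (27 / 10) ^ m * (36 / 1000 * INR m + 2304 / 10000).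

Lemma budgetP (m : nat) (kappa x : R) : (0 < m)%N -> 0 <= kappa -> budget m kappa ->
  INR m - 1 <= x <= INR m -> x * (exp x + kappa) <= 11 / 10 * INR m * exp x.
Proof.
move=> m_gt0 k_ge0 [b1 b2] [le_mx le_xm].
have m_ge1 : 1 <= INR m by have := INR_leq m_gt0; rewrite /=; lra.
have E_ge := exp_INR_ge m; set E := exp (INR m) in E_ge.
have E_gt0 : 0 < E by apply: exp_pos.
pose t := exp (x - INR m); pose k := kappa / E.
have x_eq : exp x = t * E by rewrite /t /E -exp_plus; congr exp; lra.
have k_eq : kappa = k * E by rewrite /k Rmult_assoc Rinv_l; lra.
have le_xt : x <= INR m - 1 + t by have := exp_ineq1_le (x - INR m); rewrite -/t; lra.
have t_le1 : t <= 1.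
  by rewrite /t -exp_0; apply: exp_mono; lra.
have t_ge : 36 / 100 <= t.
  by apply: Rle_trans expN1_ge _; apply: exp_mono; lra.
have k_ge0' : 0 <= k by apply: Rmult_le_pos => //; apply/Rlt_le/Rinv_0_lt_compat.
have k1 : k <= 1 / 10.
  by apply: (Rmult_le_reg_r E) => //; rewrite -k_eq; lra.
have k2 : k * (INR m - 64 / 100) <= 36 / 1000 * INR m + 2304 / 10000.
  apply: (Rmult_le_reg_r E) => //.
  have -> : k * (INR m - 64 / 100) * E = kappa * (INR m - 64 / 100) by rewrite k_eq; lra.
  apply: Rle_trans b2 _; rewrite Rmult_comm; apply: Rmult_le_compat_l => //; lra.
rewrite x_eq {1}k_eq -Rmult_plus_distr_r -!Rmult_assoc.
apply: Rmult_le_compat_r; first by lra.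
apply: Rle_trans (_ : (INR m - 1 + t) * (t + k) <= _).
  by apply: Rmult_le_compat_r; lra.
(* The difference of the two sides is a concave quadratic in [t]: up to the factor 0.64 it is the
   interpolation of its endpoint values ([g1], [g2]) plus a multiple of [g3]. *)
have g1 : 0 <= (t - 36 / 100) * (1 / 10 - k) * INR m.
  by apply: Rmult_le_pos; [apply: Rmult_le_pos|]; lra.
have g2 : 0 <= (1 - t) * (36 / 1000 * INR m + 2304 / 10000 - k * (INR m - 64 / 100)).
  by apply: Rmult_le_pos; lra.
have g3 : 0 <= (1 - t) * (t - 36 / 100) by apply: Rmult_le_pos; lra.
nra.
Qed.

(** * The estimate of log (P(N)/N) *)

(** Logarithms are taken and divided by [s]; each bit costs [ln 2 <= 7/10]. *)
Lemma pow_log_bound (m s E P N : nat) :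
  (0 < m)%N -> (0 < s)%N -> (0 < P)%N -> (0 < N)%N ->
  (P ^ (m * s) <= 2 ^ E * N ^ (m * s + s))%N ->
  INR m * (ln (INR P) - ln (INR N)) <= ln (INR N) + 7 / 10 * INR E / INR s.
Proof.
move=> m_gt0 s_gt0 P_gt0 N_gt0 /INR_leq.
have pos a : (0 < a)%N -> 0 < INR a by move=> /ltP; apply: lt_0_INR.
have [Mp Sp] := (pos _ m_gt0, pos _ s_gt0); have [Pp Np] := (pos _ P_gt0, pos _ N_gt0).
rewrite mult_INR !INR_expn => /(ln_mono (pow_lt _ _ Pp)).
have p2 : 0 < INR 2 by apply: pos.
rewrite ln_mult; try exact: pow_lt.
rewrite !ln_pow // plus_INR mult_INR => le_ln.
have le_2 : INR E * ln (INR 2) <= INR E * (7 / 10).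
  by apply: Rmult_le_compat_l; [exact: pos_INR | exact: ln2_le].
apply: (Rmult_le_reg_r (INR s)) => //.
have -> : (ln (INR N) + 7 / 10 * INR E / INR s) * INR s =
          ln (INR N) * INR s + 7 / 10 * INR E.
  by rewrite Rmult_plus_distr_r /Rdiv Rmult_assoc Rinv_l ?Rmult_1_r; lra.
nra.
Qed.

(** The bound [P(N)/N <= (e^kappa N)^(1/m)] in logarithmic form, with an affordable [kappa]. *)
Definition log_bound (m N : nat) : Prop := exists kappa,
  [/\ 0 <= kappa, budget m kappa &
     INR m * (ln (INR (pillai N)) - ln (INR N)) <= ln (INR N) + kappa].

Lemma certificate_log_bound (m s T E N : nat) :
  (0 < N)%N -> (0 < m)%N -> (0 < s)%N -> (2 ^ m <= T)%N ->
  certificate m s T (N.of_nat E) -> budget m (7 / 10 * INR E / INR s) ->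
  log_bound m N.
Proof.
move=> N_gt0 m_gt0 s_gt0 le_T cert bud; exists (7 / 10 * INR E / INR s).
have s_pos : 0 < INR s by apply/lt_0_INR/ltP.
split=> //.
  by apply: Rmult_le_pos; [have := pos_INR E; lra | apply/Rlt_le/Rinv_0_lt_compat].
apply: pow_log_bound => //; first exact: pillai_gt0.
have := certificateP cert s_gt0 _ N_gt0; rewrite ltnNge le_T /= addn0; apply.
by apply: leq_trans (leq_mul (leqnn _) le_T); rewrite -expnMn leq_expl.
Qed.

(** Only primes below about [(3/2)^m] are computed; those from there to [2^m] cost at most [2^m]
    bits together. *)
Lemma certificate_log_bound_middle (m T E N : nat) :
  (0 < N)%N -> (0 < m)%N -> (3 ^ m <= 2 ^ m * T)%N ->
  certificate m 1 T (N.of_nat E) -> budget m (7 / 10 * (INR E + 2 ^ m)) ->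
  log_bound m N.
Proof.
move=> N_gt0 m_gt0 le_T cert bud; exists (7 / 10 * (INR E + 2 ^ m)).
have p2 : 0 < 2 ^ m by apply: pow_lt; lra.
split=> //; first by have := pos_INR E; lra.
have := @pow_log_bound m 1 (E + 2 ^ m) (pillai N) N m_gt0 isT (pillai_gt0 N_gt0) N_gt0.
rewrite plus_INR INR_expn (_ : INR 1 = 1) // Rdiv_1_r; apply.
apply: leq_trans (certificateP cert isT le_T N_gt0) _.
by rewrite leq_mul2r leq_exp2l // leq_add2l; case: ifP; rewrite ?mul1n ?leqnn ?orbT.
Qed.

Lemma crude_log_bound (m N : nat) : (0 < N)%N -> (10 < m)%N ->
  budget m (7 / 10 * (2 ^ m + INR m * (INR m + 2) / 6 * ((3 / 2) ^ m + 1))) ->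
  log_bound m N.
Proof.
move=> N_gt0 m_gt10 bud.
exists (7 / 10 * (2 ^ m + INR m * (INR m + 2) / 6 * ((3 / 2) ^ m + 1))).
have p2 : 0 < 2 ^ m by apply: pow_lt; lra.
have p3 : 0 < (3 / 2) ^ m by apply: pow_lt; lra.
have m_ge0 := pos_INR m.
have small_ge0 : 0 <= INR m * (INR m + 2) / 6 * ((3 / 2) ^ m + 1) by nra.
split=> //; first by lra.
have m_gt0 : (0 < m)%N by lia.
(* [d] is [m/3] rounded up. From [m <= 2^d] the cost per small prime is [d m] bits, at most
   [m (m + 2) / 3]. *)
pose d := ((m + 2) %/ 3)%N; pose T := (3 ^ m %/ 2 ^ m)%N.
have le_d : (m <= 2 ^ d)%N.
  rewrite /d; elim/ltn_ind: m m_gt10 {bud p2 p3 m_ge0 small_ge0 m_gt0 d T} => m IH m_gt10.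
  have [lt_m|le_m] := ltnP m 14.
    by move: m lt_m m_gt10 {IH}; do 14 (case=> //).
  have {}IH := IH (m - 3)%N ltac:(lia) ltac:(lia).
  have -> : ((m + 2) %/ 3 = ((m - 3 + 2) %/ 3).+1)%N by lia.
  by rewrite expnS; lia.
have le_c : (m ^ m <= 2 ^ (d * m))%N by rewrite expnM leq_expl.
have := @pow_log_bound m 1 _ (pillai N) N m_gt0 isT (pillai_gt0 N_gt0) N_gt0.
rewrite muln1 addn1 => /(_ _ (pillai_pow_le_crude m_gt0 le_c N_gt0)) le_log.
apply: Rle_trans le_log _; rewrite (_ : INR 1 = 1) // Rdiv_1_r.
apply/Rplus_le_compat_l/Rmult_le_compat_l; first by lra.
rewrite plus_INR mult_INR mult_INR INR_expn Rplus_comm; apply: Rplus_le_compat_l.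
have d_le : INR d <= (INR m + 2) / 3.
  have : (d * 3 <= m + 2)%N by rewrite /d; lia.
  by move/INR_leq; rewrite mult_INR plus_INR /=; lra.
have T_le : INR T <= (3 / 2) ^ m.
  have : (T * 2 ^ m <= 3 ^ m)%N by apply: leq_trunc_div.
  move/INR_leq; rewrite mult_INR !INR_expn => le_T.
  apply: (Rmult_le_reg_r (2 ^ m)) => //.
  rewrite -Rpow_mult_distr (_ : 3 / 2 * 2 = 3); last by lra.
  by move: le_T; rewrite !INR_IZR_INZ.
have h_le : INR T.+1./2 <= ((3 / 2) ^ m + 1) / 2.
  have : (T.+1./2 * 2 <= T.+1)%N by lia.
  by move/INR_leq; rewrite mult_INR (S_INR T) (_ : INR 2 = 2) //; lra.
have -> : INR m * (INR m + 2) / 6 * ((3 / 2) ^ m + 1) =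
   ((INR m + 2) / 3 * INR m) * (((3 / 2) ^ m + 1) / 2) by lra.
apply: Rmult_le_compat => //; try exact: pos_INR.
  by apply: Rmult_le_pos; exact: pos_INR.
by apply: Rmult_le_compat_r.
Qed.

(** From 13 on, the left side is at most [(0.015 + 0.021) 2.7^m] by induction: the two terms grow by
    factors at most 2 and 9/5 per step. The sum 0.036 is the coefficient of [m] in the second
    inequality of [budget]. *)
Lemma budget_crude (m : nat) : (10 < m)%N ->
  budget m (7 / 10 * (2 ^ m + INR m * (INR m + 2) / 6 * ((3 / 2) ^ m + 1))).
Proof.
case: (ltnP 12 m) => [m_gt12 _|m_le12 m_gt10]; last first.
  have [->|->] : m = 11%N \/ m = 12%N by lia.
    by split; rewrite /=; lra.
  by split; rewrite /=; lra.
have pos x : 0 < x -> 0 < x ^ m by apply: pow_lt.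
have b1 : 7 / 10 * 2 ^ m <= 15 / 1000 * (27 / 10) ^ m.
  elim/ltn_ind: m m_gt12 {pos} => -[//|m] IH.
  have [->|neq] := eqVneq m 12%N; first by rewrite /=; lra.
  move=> lt; have := IH m ltac:(lia) ltac:(lia); rewrite -!tech_pow_Rmult.
  have : 0 < 2 ^ m by apply: pow_lt; lra.
  lra.
have b2 : 7 / 10 * (INR m * (INR m + 2) / 6 * ((3 / 2) ^ m + 1)) <=
          21 / 1000 * (27 / 10) ^ m.
  elim/ltn_ind: m m_gt12 {pos b1} => -[//|m] IH.
  have [->|neq] := eqVneq m 12%N; first by rewrite /=; lra.
  move=> lt; have := IH m ltac:(lia) ltac:(lia).
  have m_ge : 13 <= INR m.
    by have /INR_leq : (13 <= m)%N by [lia]; rewrite /=; lra.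
  rewrite S_INR -!tech_pow_Rmult; set y := (3 / 2) ^ m; set z := (27 / 10) ^ m.
  have y_gt0 : 0 < y by apply: pow_lt; lra.
  move=> {}IH.
  have h1 : (INR m + 1) * (INR m + 1 + 2) <= 6 / 5 * (INR m * (INR m + 2)) by nra.
  have h2 : (INR m + 1) * (INR m + 1 + 2) * (3 / 2 * y + 1) <=
     6 / 5 * (INR m * (INR m + 2)) * (3 / 2 * (y + 1)).
    by apply: Rmult_le_compat; nra.
  by nra.
have m_ge : 1 <= INR m by have /INR_leq : (1 <= m)%N by lia.
have z_gt0 : 0 < (27 / 10) ^ m by apply: pos; lra.
set k := 7 / 10 * _.
have k_le : k <= 36 / 1000 * (27 / 10) ^ m by rewrite /k; lra.
split; first by lra.
apply: Rle_trans (_ : 36 / 1000 * (27 / 10) ^ m * (INR m - 64 / 100) <= _); last by nra.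
by apply: Rmult_le_compat_r; lra.
Qed.

Lemma log_bound_all (m N : nat) : (0 < N)%N -> (0 < m)%N -> log_bound m N.
Proof.
move=> N_gt0; have [m_le10|m_gt10 _] := leqP m 10; last first.
  by apply: crude_log_bound => //; apply: budget_crude.
case: m m_le10 => [|[|[|[|[|[|[|[|[|[|[|m]]]]]]]]]]] // _ _.
(* The arguments are [m], [s], [T] and the allowed total [E] in units of [1/s] bit, with [T = 2^m].
   For [m = 9, 10], where [s = 1], [T] is [(3/2)^m] rounded up. *)
- by apply: (@certificate_log_bound 1 1 2 0) => //; split; rewrite /=; lra.
- by apply: (@certificate_log_bound 2 1 4 1) => //; split; rewrite /=; lra.
- by apply: (@certificate_log_bound 3 4 8 8) => //; split; rewrite /=; lra.
- by apply: (@certificate_log_bound 4 4 16 29) => //; split; rewrite /=; lra.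
- by apply: (@certificate_log_bound 5 4 32 65) => //; split; rewrite /=; lra.
- by apply: (@certificate_log_bound 6 1 64 39) => //; split; rewrite /=; lra.
- by apply: (@certificate_log_bound 7 1 128 74) => //; split; rewrite /=; lra.
- by apply: (@certificate_log_bound 8 1 256 142) => //; split; rewrite /=; lra.
- by apply: (@certificate_log_bound_middle 9 39 90) => //; split; rewrite /=; lra.
- by apply: (@certificate_log_bound_middle 10 58 132) => //; split; rewrite /=; lra.
Qed.

(** Take [m = up x] with [x = ln L] and [L = ln N], so that [m - 1 <= x <= m] and [exp x = L];
    [budgetP] then turns [(L + kappa)/m] into [1.1 L / x]. [N >= 3 > e] makes [x] positive. *)
Lemma pillai_log_le (N : nat) : (2 < N)%N ->
  0 < ln (ln (INR N)) /\
  ln (INR (pillai N)) - ln (INR N) <= 11 / 10 * ln (INR N) / ln (ln (INR N)).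
Proof.
move=> N_gt2; have N_gt0 : (0 < N)%N by lia.
have N_ge3 : 3 <= INR N by have /INR_leq := N_gt2; rewrite /=; lra.
have L_gt1 : 1 < ln (INR N).
  rewrite -{1}(ln_exp 1); apply: ln_increasing; first exact: exp_pos.
  by have := exp1_lt3; lra.
set L := ln (INR N) in L_gt1 *; set x := ln L.
have x_gt0 : 0 < x by rewrite -ln_1; apply: ln_increasing; lra.
split=> //.
have exp_x : exp x = L by apply: exp_ln; lra.
have [up_gt up_le] := archimed x.
pose m := Z.to_nat (up x).
have up_pos : (0 < up x)%Z by apply: lt_IZR; lra.
have m_eq : INR m = IZR (up x) by rewrite INR_IZR_INZ; congr IZR; rewrite /m; lia.
have m_gt0 : (0 < m)%N by rewrite /m; lia.
have [kappa [k_ge0 bud le_log]] := log_bound_all N_gt0 m_gt0.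
have := budgetP m_gt0 k_ge0 bud (_ : INR m - 1 <= x <= INR m).
rewrite exp_x m_eq -/L => /(_ ltac:(lra)) le_x.
apply: (Rmult_le_reg_r x) => //.
have -> : 11 / 10 * L / x * x = 11 / 10 * L by rewrite /Rdiv Rmult_assoc Rinv_l; lra.
rewrite m_eq -/L in le_log.
have m_pos : 0 < IZR (up x) by lra.
apply: (Rmult_le_reg_l (IZR (up x))) => //.
have : IZR (up x) * (ln (INR (pillai N)) - L) * x <= (L + kappa) * x.
  by apply: Rmult_le_compat_r; lra.
lra.
Qed.

(** * The lower bound for (q-1)^r and the comparison with tau *)

Lemma pow_ge_bernoulli (x : R) (j : nat) : -1 <= x -> 1 + INR j * x <= (1 + x) ^ j.
Proof.
move=> x_ge; elim: j => [|j IH]; first by rewrite /=; lra.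
rewrite S_INR -tech_pow_Rmult.
have : (1 + x) * (1 + INR j * x) <= (1 + x) * (1 + x) ^ j.
  by apply: Rmult_le_compat_l; lra.
have : 0 <= INR j * (x * x) by apply: Rmult_le_pos; [exact: pos_INR | nra].
lra.
Qed.

(* Bernoulli's inequality applied to the power [q / 2] gives [(1 - 1/q)^(q/2) >= 1/2]. *)
Lemma one_sub_inv_pow_ge (q : nat) : (1 < q)%N -> 1 / 4 <= (1 - / INR q) ^ q.
Proof.
move=> q_gt1; pose h := q./2.
have q_eq : q = (odd q + (h + h))%N by rewrite addnn odd_double_half.
have h_gt0 : (0 < h)%N by rewrite /h; lia.
have h_ge1 : 1 <= INR h by have /INR_leq := h_gt0.
have Q_eq : INR q = INR (odd q) + 2 * INR h by rewrite {1}q_eq !plus_INR; lra.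
have odd_ge0 := pos_INR (odd q).
set y := / INR q.
have y_gt0 : 0 < y by apply: Rinv_0_lt_compat; lra.
have yq : y * INR q = 1 by apply: Rinv_l; lra.
have bern : 1 - INR h * y <= (1 - y) ^ h.
  have y_le1 : -1 <= - y by nra.
  by have := pow_ge_bernoulli h y_le1; rewrite (_ : 1 + - y = 1 - y); lra.
have -> : (1 - y) ^ q = (1 - y) ^ odd q * ((1 - y) ^ h * (1 - y) ^ h).
  by rewrite {1}q_eq !pow_add.
have half_ge0 : 0 <= 1 - INR h * y by nra.
have sq_ge : (1 - INR h * y) * (1 - INR h * y) <= (1 - y) ^ h * (1 - y) ^ h.
  exact: Rmult_le_compat.
move: Q_eq sq_ge; case: (odd q) => /= Q_eq sq_ge; last first.
  have hy : INR h * y = 1 / 2 by nra.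
  by rewrite hy in sq_ge; lra.
(* For odd [q] a factor [1 - y] is left over, and [(1 - y) ((1 + y)/2)^2 >= 1/4] because
   [y <= 1/3]. *)
have hy : INR h * y = (1 - y) / 2 by nra.
have y_le : y <= 1 / 3 by nra.
rewrite Rmult_1_r; apply: Rle_trans (Rmult_le_compat_l (1 - y) _ _ _ sq_ge); last by lra.
rewrite hy; nra.
Qed.

(** This is the power [r/q] of [(1 - 1/q)^q >= 1/4], times [q^r]. *)
Lemma pow_pred_ge (q r : nat) : (1 < q)%N ->
  Rpower 4 (- INR r / INR q) * Rpower (INR q) (INR r) <= INR ((q - 1) ^ r)%N.
Proof.
move=> q_gt1.
have q_ge2 : 2 <= INR q by have /INR_leq := q_gt1; rewrite /=; lra.
have inv_gt0 : 0 < / INR q by apply: Rinv_0_lt_compat; lra.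
have inv_q : / INR q * INR q = 1 by apply: Rinv_l; lra.
have base_gt0 : 0 < 1 - / INR q by nra.
have -> : INR ((q - 1) ^ r)%N = (1 - / INR q) ^ r * INR q ^ r.
  rewrite INR_expn -Rpow_mult_distr; congr (_ ^ _).
  by rewrite minus_INR /=; [lra | lia].
rewrite Rpower_pow; last by lra.
apply: Rmult_le_compat_r; first by apply: pow_le; lra.
rewrite -Rpower_pow // /Rpower; apply: exp_mono.
have := ln_mono _ (one_sub_inv_pow_ge q_gt1); rewrite ln_pow // => /(_ ltac:(lra)).
have -> : ln (1 / 4) = - ln 4 by rewrite /Rdiv Rmult_1_l ln_Rinv; lra.
move=> le_ln.
have : INR r * / INR q * - ln 4 <= INR r * / INR q * (INR q * ln (1 - / INR q)).
  apply: Rmult_le_compat_l => //.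
  by apply: Rmult_le_pos; [exact: pos_INR | lra].
have -> : INR r * / INR q * (INR q * ln (1 - / INR q)) =
          INR r * ln (1 - / INR q) * (/ INR q * INR q) by lra.
rewrite inv_q /Rdiv; lra.
Qed.

(** Since [ln N <= n ln q], the estimate of [P(N)/N] becomes [q^w] with [w = 1.1 n / ln ln N];
    dividing [(q-1)^(n-k)] by it gives [tau]. *)
Lemma tau_le (q n k t : nat) : (1 < q)%N -> (2 <= n)%N -> (k < n)%N ->
  ((q - 1) ^ (n - k) * (q ^ n - 1) <= t * pillai (q ^ n - 1))%N ->
  tau k q n <= INR t.
Proof.
move=> q_gt1 n_ge2 lt_kn; set N := (q ^ n - 1)%N => le_t.
have N_gt2 : (2 < N)%N.
  have : (2 ^ 2 <= q ^ n)%N.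
    by apply: leq_trans (leq_expl _ q_gt1) _; rewrite leq_exp2l // ltnW.
  by rewrite /N; lia.
have q_ge2 : (2 <= INR q) by have /INR_leq := q_gt1; rewrite /=; lra.
have N_eq : (INR q ^ n - 1) = INR N.
  by rewrite /N minus_INR ?INR_expn //; lia.
have [ll_gt0 log_le] := pillai_log_le N_gt2.
rewrite /tau N_eq; set ll := ln (ln (INR N)) in ll_gt0 log_le *.
set w := (11 / 10 * INR n / ll).
have N_pos : (0 < INR N) by apply/lt_0_INR/ltP; lia.
have P_pos : (0 < INR (pillai N)) by apply/lt_0_INR/ltP/pillai_gt0; lia.
have W_ge : (INR (pillai N) <= Rpower (INR q) w * INR N).
  rewrite -(exp_ln _ P_pos) -{1}(exp_ln _ N_pos) /Rpower -exp_plus; apply: exp_mono.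
  have lnN_le : (ln (INR N) <= INR n * ln (INR q)).
    rewrite -ln_pow; last by lra.
    by apply: ln_mono => //; rewrite -N_eq; lra.
  have : (11 / 10 * ln (INR N) / ll <= w * ln (INR q)).
    rewrite /w /Rdiv.
    have -> : 11 * / 10 * INR n * / ll * ln (INR q) =
              11 * / 10 * (INR n * ln (INR q)) * / ll by lra.
    apply: Rmult_le_compat_r; first exact/Rlt_le/Rinv_0_lt_compat.
    lra.
  lra.
have W_pos : (0 < Rpower (INR q) w) by apply: exp_pos.
have := @pow_pred_ge q (n - k) q_gt1.
have nk_eq : INR (n - k) = (INR n - INR k) by rewrite minus_INR //; lia.
rewrite nk_eq Ropp_minus_distr; set A := Rpower 4 _ => le_A.
move/INR_leq: le_t; rewrite !mult_INR => le_t.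
apply: (Rmult_le_reg_r (Rpower (INR q) w * INR N)); first exact: Rmult_lt_0_compat.
have -> : (A * Rpower (INR q) (INR n - INR k - w) * (Rpower (INR q) w * INR N) =
  A * Rpower (INR q) (INR n - INR k) * INR N).
  have <- : (Rpower (INR q) (INR n - INR k - w) * Rpower (INR q) w =
             Rpower (INR q) (INR n - INR k)).
    by rewrite -Rpower_plus; congr Rpower; lra.
  lra.
have := Rmult_le_compat_r (INR N) _ _ (Rlt_le _ _ N_pos) le_A.
have := Rmult_le_compat_l (INR t) _ _ (pos_INR t) W_ge.
lra.
Qed.

End RealBounds.

Theorem theorem4p1 (F : finFieldType) (L : fieldExtType F) (q n k : nat) :
  #|F| = q ->
  \dim {:L}%VS = n ->
  (2 <= n)%N ->
  (k <= n - 1)%N ->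
  (exists a : L, k_normal q n k a) ->
  exists a : {unit finvect_type L},
    k_normal q n k (FinRing.uval a) /\ (tau k q n <= INR #[a]%g)%R.
Proof.
move=> <- <- n_ge2 k_le [x x_normal].
have lt_kn : (k < \dim {:L}%VS)%N by lia.
have [a [a_normal le_a]] := exists_k_normal_large_order lt_kn x_normal.
exists a; split=> //; apply: tau_le le_a => //; exact: finNzRing_gt1.
Qed.
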